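(* Let $\mathcal R$ be a unital ring, let $M$ be a right $\mathcal R$-module with $Th(M)=Th(M)^{\aleph_0}$ and let $n\ge1$. Let $A$ and $B_i$ ($1\le i\le m$) be connected definable subsets of $M^n$ such that $\lambda\left(\bigcup_{i=1}^mB_i\right)=m$. If $A\subseteq\bigcup_{i=1}^mB_i$, then $A\subseteq B_i$ for a unique $i$.
   Context: **pp-sets.** A right $\mathcal R$-module $M$ is viewed as a first order structure in the language $\langle 0,+,-,m_r: r\in\mathcal R\rangle$; ''definable'' means definable with parameters from $M$. A pp-formula is a formula equivalent to one of the form $\exists y_1\dots\exists y_m\bigwedge_{i=1}^t\left(\sum_j x_jr_{ij}+\sum_k y_ks_{ik}+c_i=0\right)$ with $r_{ij},s_{ik}\in\mathcal R$ and parameters $c_i\in M$. A pp-set is a subset of $M^n$ defined by a pp-formula; it is empty or a coset of a subgroup of $M^n$ defined by a parameter-free pp-formula (a pp-definable subgroup). $\mathcal L$ is the meet-semilattice (under intersection) of pp-subsets of $M^n$ ($n$ fixed). **The condition $Th(M)=Th(M)^{\aleph_0}$** means $M\equiv M^{(\aleph_0)}$; equivalently, for every $k\ge1$ and all pp-definable subgroups $G,H$ of $M^k$, the index $[G:G\cap H]$ is $1$ or infinite. **Blocks, nests, cores.** A block is a set $B=A\setminus\bigcup\beta$ where $A$ is a nonempty pp-set and $\beta$ is a finite antichain of nonempty pp-sets properly contained in $A$; under the condition $Th(M)=Th(M)^{\aleph_0}$, $A$ and $\beta$ are uniquely determined by $B$ and one writes $P(B)=\{A\}$, $N(B)=\beta$.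 Every definable subset of $M^n$ is a finite disjoint union of blocks. A nest is a finite sub-meet-semilattice of $\mathcal L$. The nest corresponding to a finite partition $D=\bigsqcup_iB_i$ of a definable set into blocks is the smallest sub-meet-semilattice of $\mathcal L$ containing $\bigcup_i(P(B_i)\cup N(B_i))$. For a nest $\mathcal D$ and nonempty $F\in\mathcal D$, $\mathrm{Core}_{\mathcal D}(F):=F\setminus\bigcup\{G\in\mathcal D:G\cap F\subsetneq F\}$. If $\mathcal D$ contains the nest corresponding to some partition of $D$ into blocks, then each core is either contained in or disjoint from $D$; put $\mathcal D^+:=\{F\in\mathcal D: F\ne\emptyset,\ \mathrm{Core}_{\mathcal D}(F)\subseteq D\}$, so $D=\bigcup_{F\in\mathcal D^+}\mathrm{Core}_{\mathcal D}(F)$. **Connectedness.** $\mathcal H(\mathcal D^+)$ is the digraph with vertex set $\mathcal D^+$ and an arrow $(F_1,F_2)$ whenever $F_1\subsetneq F_2$ and no $F\in\mathcal D^+$ satisfies $F_1\subsetneq F\subsetneq F_2$. Weakly connected components are the connected components of the underlying undirected graph. For nonempty definable $D$, fix a partition of $D$ into finitely many blocks; $\lambda(D)$ is the least number of weakly connected components of $\mathcal H(\mathcal D^+)$ where $\mathcal D$ ranges over nests containing the nest corresponding to this partition. $\lambda(\emptyset)=0$. A definable set $D$ is connected if $\mathcal H(\mathcal D^+)$ is weakly connected for some such nest $\mathcal D$, i.e. iff $\lambda(D)=1$. *)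

(* Defs.v *)
(* MathComp world, with the classical layer of MathComp-Analysis. *)
From HB Require Import structures.
From mathcomp Require Import all_boot all_order all_algebra finmap.
From mathcomp Require Import boolp classical_sets functions cardinality.

Set Implicit Arguments.
Unset Strict Implicit.
Unset Printing Implicit Defensive.

Import GRing.Theory.
Local Open Scope classical_set_scope.
Local Open Scope ring_scope.

(* A right R-module is a left module over the converse ring R^c. *)
Definition rscale (R : pzRingType) (M : lmodType R^c) (x : M) (r : R) : M :=
  (r : R^c) *: x.

Section FirstOrder.
Variable R : pzRingType.

Inductive term (n : nat) : Type :=
| TVar of 'I_n
| TZero
| TAdd of term n & term n
| TOpp of term n
| TScale of term n & R.

(* [formula n] is the type of parameter-free formulas whose free variables are
   indexed by 'I_n; the quantifier binds the variable of index 0.  The omitted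
   connectives are definable, the semantics being classical. *)
Inductive formula : nat -> Type :=
| FEq n of term n & term n : formula n
| FNot n of formula n : formula n
| FAnd n of formula n & formula n : formula n
| FEx n of formula n.+1 : formula n.

Definition vcons (M : Type) n (x : M) (v : 'I_n -> M) : 'I_n.+1 -> M :=
  fun i => if unlift ord0 i is Some j then v j else x.

Definition vcat (M : Type) n k (v : 'I_n -> M) (w : 'I_k -> M) :
    'I_(n + k)%N -> M :=
  fun i => match fintype.split i with inl j => v j | inr j => w j end.

Fixpoint teval (M : lmodType R^c) n (v : 'I_n -> M) (t : term n) : M :=
  match t with
  | TVar i => v i
  | TZero => 0
  | TAdd t1 t2 => teval v t1 + teval v t2
  | TOpp t1 => - teval v t1
  | TScale t1 r => rscale (teval v t1) r
  end.

Fixpoint sat (M : lmodType R^c) n (phi : formula n) : ('I_n -> M) -> Prop :=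
  match phi in formula n return ('I_n -> M) -> Prop with
  | FEq _ t1 t2 => fun v => teval v t1 = teval v t2
  | FNot _ f => fun v => ~ sat f v
  | FAnd _ f g => fun v => sat f v /\ sat g v
  | FEx _ f => fun v => exists x : M, sat f (vcons x v)
  end.

Definition Th (M : lmodType R^c) : set (formula 0) :=
  [set phi | sat phi (fun=> 0 : M)].

Definition definable (M : lmodType R^c) n (X : set ('I_n -> M)) : Prop :=
  exists k (phi : formula (n + k)%N) (a : 'I_k -> M),
    X = [set x | sat phi (vcat x a)].

End FirstOrder.

Section DirectSum.
Variables (R : pzRingType) (M : lmodType R^c).

Definition finite_support : {pred nat -> M} :=
  fun f => `[< finite_set [set i | f i <> 0] >].

Lemma finite_support_submod : submod_closed finite_support.
Proof.
split=> [|a f g /asboolP ff /asboolP fg]; apply/asboolP.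
  rewrite (_ : [set i | _] = set0) //.
  by apply/seteqP; split=> i //=.
apply: (@sub_finite_set _ _ ([set i | f i <> 0] `|` [set i | g i <> 0])).
  move=> i /= nz; have [f0|] := pselect (f i = 0); last by left.
  right=> g0; apply: nz.
  by rewrite /GRing.add /= /GRing.scale /= f0 g0 scaler0 addr0.
by rewrite finite_setU.
Qed.

HB.instance Definition _ :=
  GRing.isSubmodClosed.Build R^c (nat -> M) finite_support finite_support_submod.

(* The direct sum of countably many copies of M. *)
Record aleph0_sum : Type := Aleph0Sum {
  aleph0_sum_val :> nat -> M;
  _ : aleph0_sum_val \in finite_support }.

HB.instance Definition _ := [isSub for aleph0_sum_val].
HB.instance Definition _ := [Choice of aleph0_sum by <:].
HB.instance Definition _ := [SubChoice_isSubLmodule of aleph0_sum by <:].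

End DirectSum.

Definition Th_eq_Th_aleph0 (R : pzRingType) (M : lmodType R^c) : Prop :=
  Th M = Th (aleph0_sum M).

Section PPSets.
Variables (R : pzRingType) (M : lmodType R^c) (n : nat).
Implicit Types (X A F G : set ('I_n -> M)) (D : {fset set ('I_n -> M)}).

Definition pp_set X : Prop :=
  exists (m t : nat) (r : 'I_t -> 'I_n -> R) (s : 'I_t -> 'I_m -> R)
         (c : 'I_t -> M),
    X = [set x | exists y : 'I_m -> M, forall i : 'I_t,
      \sum_j rscale (x j) (r i j) + \sum_k rscale (y k) (s i k) + c i = 0].

(* A block is represented by the pair (A, beta) with B = A minus the union of
   beta; when Th(M) = Th(M)^aleph0 this pair is determined by B. *)
Definition block_data : Type :=
  (set ('I_n -> M) * {fset set ('I_n -> M)})%type.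

Definition block_set (b : block_data) : set ('I_n -> M) :=
  b.1 `\` \bigcup_(G in [set` b.2]) G.

Definition is_block (b : block_data) : Prop :=
  [/\ pp_set b.1, b.1 !=set0,
      forall G, G \in b.2 -> [/\ pp_set G, G !=set0 & G `<` b.1]
    & forall G H, G \in b.2 -> H \in b.2 -> G `<=` H -> G = H].

Definition block_partition X (p : {fset block_data}) : Prop :=
  [/\ forall b, b \in p -> is_block b,
      trivIset [set` p] block_set
    & \bigcup_(b in [set` p]) block_set b = X].

Definition sub_semilattice (S : set (set ('I_n -> M))) : Prop :=
  S `<=` pp_set /\ setI_closed S.

Definition nest D : Prop := sub_semilattice [set` D].

Definition nest_of_partition (p : {fset block_data}) :
    set (set ('I_n -> M)) :=
  smallest sub_semilattice
    (\bigcup_(b in [set` p]) ([set b.1] `|` [set` b.2])).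

Definition core D F : set ('I_n -> M) :=
  F `\` \bigcup_(G in [set G | G \in D /\ G `&` F `<` F]) G.

(* D^+ *)
Definition positive_part X D : {fset set ('I_n -> M)} :=
  [fset F in D | `[< (F !=set0 /\ core D F `<=` X)%classic >]]%fset.

Definition arrow (V : {fset set ('I_n -> M)}) : rel V :=
  fun F1 F2 : V => `[< val F1 `<` val F2 /\
    ~ exists F : V, val F1 `<` val F /\ val F `<` val F2 >].

Definition weak_components (V : {fset set ('I_n -> M)}) : nat :=
  n_comp [rel F1 F2 : V | arrow F1 F2 || arrow F2 F1] predT.

(* The partition into blocks that is fixed once and for all for X; one exists
   whenever X is definable, so the default value is then irrelevant. *)
Definition fixed_partition X : {fset block_data} :=
  xget fset0 [set p | block_partition X p].

Definition admissible_nest X D : Prop :=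
  nest D /\ nest_of_partition (fixed_partition X) `<=` [set` D].

Definition component_counts X : set nat :=
  [set k | exists2 D, admissible_nest X D &
                      weak_components (positive_part X D) = k].

Definition lambda X : nat :=
  if X == set0 then 0%N
  else xget 0%N [set k | component_counts X k /\
                   forall l, component_counts X l -> (k <= l)%N].

Definition connected_definable X : Prop :=
  [/\ definable X, X !=set0 &
      exists2 D, admissible_nest X D &
                 weak_components (positive_part X D) = 1%N].

End PPSets.

(* Main.v *)
(* Call a pp-set F generic in X if F, minus finitely many pp-sets none of which
   contains F, is contained in X.  For every nest D adapted to X, sending F to
   the least member of D containing it retracts the poset of sets generic in X
   onto D^+, and F is contained in its image; so both posets have the same
   components, and the number of components of H(D^+) does not depend on D.
   If B is connected and contained in X, the sets generic in B are generic in X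
   and lie in one component.  Thus the B_i cover the components of their union
   X; as there are m of each, distinct B_i yield distinct components.  Since {x}
   is generic in A for x in A, and in B_i for x in B_i, every B_i meeting the
   connected set A lies in the component of A, and there is only one such B_i.

   That a pp-set is covered by finitely many others only if one of them contains
   it is transferred from the direct sum, where it is seen by choosing
   coordinates outside the supports of the finitely many translation vectors.
   The same fact yields the elimination of quantifiers down to Boolean
   combinations of pp-sets. *)
Require Import Defs.
From mathcomp Require Import all_boot all_order all_algebra finmap.
From mathcomp Require Import boolp classical_sets functions cardinality.

Import GRing.Theory.
Local Open Scope classical_set_scope.
Local Open Scope ring_scope.

Set Implicit Arguments.
Unset Strict Implicit.
Unset Printing Implicit Defensive.

Lemma rscaleDl (R : pzRingType) (N : lmodType R^c) (x y : N) r :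
  rscale (x + y) r = rscale x r + rscale y r.
Proof. exact: scalerDr. Qed.

Lemma rscaleNl (R : pzRingType) (N : lmodType R^c) (x : N) r :
  rscale (- x) r = - rscale x r.
Proof. exact: scalerN. Qed.

Lemma rscale0l (R : pzRingType) (N : lmodType R^c) r : rscale (0 : N) r = 0.
Proof. exact: scaler0. Qed.

Lemma vcat_lshift (T : Type) n k (v : 'I_n -> T) (w : 'I_k -> T) i :
  vcat v w (lshift k i) = v i.
Proof. by rewrite /vcat -[lshift k i]/(unsplit (inl i)) unsplitK. Qed.

Lemma vcat_rshift (T : Type) n k (v : 'I_n -> T) (w : 'I_k -> T) i :
  vcat v w (rshift n i) = w i.
Proof. by rewrite /vcat -[rshift n i]/(unsplit (inr i)) unsplitK. Qed.

Lemma vcons_ord0 (T : Type) n (x : T) (v : 'I_n -> T) : vcons x v ord0 = x.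
Proof. by rewrite /vcons unlift_none. Qed.

Lemma vcons_lift (T : Type) n (x : T) (v : 'I_n -> T) i :
  vcons x v (lift ord0 i) = v i.
Proof. by rewrite /vcons liftK. Qed.

Lemma vcons_eta (T : Type) n (v : 'I_n.+1 -> T) :
  vcons (v ord0) (v \o lift ord0) = v.
Proof.
apply: funext => i; case: (unliftP ord0 i) => [j|] ->.
  by rewrite vcons_lift.
by rewrite vcons_ord0.
Qed.

Lemma vcons_vcat (T : Type) n k (x : T) (w : 'I_n -> T) (v : 'I_k -> T) :
  vcons x (vcat w v) = vcat (vcons x w) v.
Proof.
apply: funext => i; rewrite -(splitK (i : 'I_(n.+1 + k))).
case: (fintype.split _) => j /=.
  rewrite vcat_lshift; case: (unliftP ord0 j) => [l|] ->.
    rewrite (_ : lshift k _ = lift ord0 (lshift k l) :> 'I_(n.+1 + k));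
      last exact: val_inj.
    by rewrite !vcons_lift vcat_lshift.
  rewrite (_ : lshift k _ = ord0 :> 'I_(n.+1 + k)); last exact: val_inj.
  by rewrite !vcons_ord0.
rewrite vcat_rshift (_ : rshift _ _ = lift ord0 (rshift n j) :> 'I_(n.+1 + k));
  last exact: val_inj.
by rewrite vcons_lift vcat_rshift.
Qed.

(** * Formulas uniform in the module *)

Section UniformDefinability.
Variable R : pzRingType.
Implicit Types N : lmodType R^c.

Lemma sat_exists_vcat k m (phi : formula R (k + m)) :
  exists psi : formula R m, forall N (v : 'I_m -> N),
    sat psi v <-> exists w : 'I_k -> N, sat phi (vcat w v).
Proof.
elim: k phi => [|k IHk] phi.
  exists phi => N v.
  have vcat0 (w : 'I_0 -> N) : vcat w v = v.
    by apply: funext => i; rewrite -[RHS](vcat_rshift w); congr vcat; apply: val_inj.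
  split=> [sv|[w]]; last by rewrite vcat0.
  by exists (fun=> 0); rewrite vcat0.
have [psi psiP] := IHk (FEx phi).
exists psi => N v; rewrite psiP; split=> [[w] /= [x sx]|[w sw]].
  by exists (vcons x w); rewrite -vcons_vcat.
exists (w \o lift ord0); exists (w ord0).
by rewrite vcons_vcat vcons_eta.
Qed.

(* Precomposing with an arbitrary renaming [f] of the variables makes these two
   notions stable under substitution, with no renaming operation on formulas. *)
Definition uniform_term (V : Type) (t : forall N, (V -> N) -> N) : Prop :=
  forall m (f : V -> 'I_m), exists tau : term R m,
    forall N (v : 'I_m -> N), teval v tau = t N (v \o f).

Definition uniform_formula (V : Type) (P : forall N, (V -> N) -> Prop) : Prop :=
  forall m (f : V -> 'I_m), exists phi : formula R m,
    forall N (v : 'I_m -> N), sat phi v <-> P N (v \o f).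

Lemma uniform_var V (i : V) : uniform_term (fun N v => v i).
Proof. by move=> m f; exists (TVar R (f i)). Qed.

Lemma uniform_sub V (t u : forall N, (V -> N) -> N) :
  uniform_term t -> uniform_term u -> uniform_term (fun N v => t N v - u N v).
Proof.
move=> ht hu m f; have [tau tE] := ht m f; have [mu uE] := hu m f.
by exists (TAdd tau (TOpp mu)) => N v /=; rewrite tE uE.
Qed.

Lemma uniform_add V (t u : forall N, (V -> N) -> N) :
  uniform_term t -> uniform_term u -> uniform_term (fun N v => t N v + u N v).
Proof.
move=> ht hu m f; have [tau tE] := ht m f; have [mu uE] := hu m f.
by exists (TAdd tau mu) => N v /=; rewrite tE uE.
Qed.

Lemma uniform_sum_scale V (I : finType) (r : I -> R)
    (t : I -> forall N, (V -> N) -> N) :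
  (forall i, uniform_term (t i)) ->
  uniform_term (fun N v => \sum_i rscale (t i N v) (r i)).
Proof.
move=> ht m f; elim: (index_enum I) => [|i s [tau tE]].
  by exists (TZero R m) => N v; rewrite big_nil.
have [mu uE] := ht i m f.
by exists (TAdd (TScale mu (r i)) tau) => N v; rewrite big_cons /= tE uE.
Qed.

Lemma uniform_eq0 V (t : forall N, (V -> N) -> N) :
  uniform_term t -> uniform_formula (fun N v => t N v = 0).
Proof.
move=> ht m f; have [tau tE] := ht m f.
by exists (FEq tau (TZero R m)) => N v /=; rewrite tE.
Qed.

Lemma uniform_not V (P : forall N, (V -> N) -> Prop) :
  uniform_formula P -> uniform_formula (fun N v => ~ P N v).
Proof.
by move=> hP m f; have [phi pE] := hP m f; exists (FNot phi) => N v /=; rewrite pE.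
Qed.

Lemma uniform_and V (P Q : forall N, (V -> N) -> Prop) :
  uniform_formula P -> uniform_formula Q ->
  uniform_formula (fun N v => P N v /\ Q N v).
Proof.
move=> hP hQ m f; have [phi pE] := hP m f; have [psi qE] := hQ m f.
by exists (FAnd phi psi) => N v /=; rewrite pE qE.
Qed.

Lemma uniform_all V (I : finType) (Q : I -> Prop)
    (P : I -> forall N, (V -> N) -> Prop) :
  (forall i, uniform_formula (P i)) ->
  uniform_formula (fun N v => forall i, Q i -> P i N v).
Proof.
move=> hP m f.
have [phi pE] : exists phi : formula R m, forall N (v : 'I_m -> N),
    sat phi v <-> forall i, i \in enum I -> Q i -> P i N (v \o f).
  elim: (enum I) => [|i s [phi pE]].
    by exists (FEq (TZero R m) (TZero R m)) => N v.
  have [psi qE] := hP i m f.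
  have [Qi|nQi] := pselect (Q i).
    exists (FAnd psi phi) => N v /=; rewrite pE qE; split.
      by move=> [Pi Ps] j; rewrite inE => /orP[/eqP->|/Ps].
    by move=> Ps; split=> [|j js]; apply: Ps; rewrite ?inE ?eqxx ?js ?orbT.
  exists phi => N v /=; rewrite pE; split=> Ps j.
    by rewrite inE => /orP[/eqP->|/Ps].
  by move=> js; apply: Ps; rewrite inE js orbT.
exists phi => N v; rewrite pE; split=> [Ps i|Ps i _]; last exact: Ps.
by apply: Ps; rewrite mem_enum.
Qed.

Definition fjoin (T V W : Type) (v : V -> T) (w : W -> T) (s : V + W) : T :=
  match s with inl a => v a | inr b => w b end.

Lemma uniform_exists V (W : finType) (P : forall N, (V + W -> N) -> Prop) :
  uniform_formula P ->
  uniform_formula (fun N v => exists w : W -> N, P N (fjoin v w)).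
Proof.
move=> hP m f.
pose g (s : V + W) := match s with
  inl a => rshift #|W| (f a) | inr b => lshift m (enum_rank b) end.
have [phi pE] := hP _ g; have [psi qE] := sat_exists_vcat phi.
have gE N (w : 'I_#|W| -> N) v :
    vcat w v \o g = fjoin (v \o f) (w \o enum_rank).
  by apply: funext => -[a|b] /=; rewrite ?vcat_lshift ?vcat_rshift.
exists psi => N v; rewrite qE; split=> [[w]|[w Pw]].
  by rewrite pE gE => Pw; exists (w \o enum_rank).
exists (w \o enum_val); rewrite pE gE; congr (P N (fjoin _ _)): Pw.
by apply: funext => b /=; rewrite enum_rankK.
Qed.

Lemma uniform_sentence (M N : lmodType R^c) (P : forall N, (void -> N) -> Prop) :
  uniform_formula P -> Th M = Th N ->
  P M (fun=> 0) -> P N (fun=> 0).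
Proof.
move=> hP eqT; have [phi pE] := hP 0%N (fun v : void => match v with end).
have thE (K : lmodType R^c) : Th K phi <-> P K (fun=> 0).
  have void_eq (u : void -> K) : u = (fun=> 0) by apply: funext => -[].
  by have := pE K (fun=> 0); rewrite [_ \o _]void_eq.
by move/thE; rewrite eqT => /thE.
Qed.

End UniformDefinability.

Section Systems.
Variable R : pzRingType.
Implicit Types N : lmodType R^c.

Record pp_system (n : nat) := PPSystem {
  pp_wit : nat;
  pp_eqs : nat;
  pp_coef : 'I_pp_eqs -> 'I_n -> R;
  pp_wcoef : 'I_pp_eqs -> 'I_pp_wit -> R }.

Definition pp_sol n (S : pp_system n) N (c : 'I_(pp_eqs S) -> N) :
    set ('I_n -> N) :=
  [set x | exists y : 'I_(pp_wit S) -> N, forall i,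
    \sum_j rscale (x j) (pp_coef i j) + \sum_k rscale (y k) (pp_wcoef i k)
      + c i = 0].

Definition pp_sol0 n (S : pp_system n) N := @pp_sol n S N (fun=> 0).

Lemma pp_setP N n (X : set ('I_n -> N)) :
  pp_set X <-> exists (S : pp_system n) c, X = pp_sol (S := S) c.
Proof.
split=> [[m [t [r [s [c ->]]]]]|[[m t r s] [c ->]]].
  by exists (PPSystem r s), c.
by exists m, t, r, s, c.
Qed.

Lemma pp_solB n (S : pp_system n) N c c' (x x' : 'I_n -> N) :
  pp_sol (S := S) c x -> pp_sol (S := S) c' x' ->
  pp_sol (S := S) (fun i => c i - c' i) (fun j => x j - x' j).
Proof.
move=> [y hy] [y' hy']; exists (fun k => y k - y' k) => i.
have sumB (I : finType) (u v : I -> N) (r : I -> R) :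
    \sum_j rscale (u j - v j) (r j) =
    \sum_j rscale (u j) (r j) - \sum_j rscale (v j) (r j).
  by rewrite -sumrB; apply: eq_bigr => j _; rewrite rscaleDl rscaleNl.
by rewrite !sumB [X in X + _]addrACA -opprD addrACA -opprD hy hy' subr0.
Qed.

Lemma pp_sol_coset n (S : pp_system n) N c (x x' : 'I_n -> N) :
  pp_sol (S := S) c x ->
  pp_sol c x' <-> pp_sol0 S (fun j => x' j - x j).
Proof.
move=> cx; split=> [cx'|cxx'].
  suff : pp_sol (S := S) (fun i => c i - c i) (fun j => x' j - x j).
    by congr pp_sol; apply: funext => i; rewrite subrr.
  exact: pp_solB.
have c0 : pp_sol0 S (fun j => x j - x j).
  rewrite /pp_sol0 (_ : (fun=> 0) = fun i => c i - c i).
    exact: pp_solB.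
  by apply: funext => i; rewrite subrr.
have Nx : pp_sol (S := S) (fun i => 0 - c i) (fun j => (x j - x j) - x j).
  exact: pp_solB.
have := pp_solB cxx' Nx; congr pp_sol; apply: funext => i.
  by rewrite !sub0r opprK.
by rewrite subrr sub0r opprK subrK.
Qed.

Lemma uniform_pp_sol0 n (S : pp_system n) V
    (t : 'I_n -> forall N, (V -> N) -> N) :
  (forall j, uniform_term (t j)) ->
  uniform_formula (fun N v => pp_sol0 S (fun j => t j N v)).
Proof.
move=> ht; rewrite /pp_sol0 /pp_sol /=.
apply: (@uniform_exists _ _ _ (fun N (u : V + 'I_(pp_wit S) -> N) =>
  forall i, \sum_j rscale (t j N (u \o inl)) (pp_coef i j)
    + \sum_k rscale (u (inr k)) (pp_wcoef i k) + 0 = 0)).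
move=> m f.
have ui i : uniform_formula (fun N (u : V + 'I_(pp_wit S) -> N) =>
    \sum_j rscale (t j N (u \o inl)) (pp_coef i j)
    + \sum_k rscale (u (inr k)) (pp_wcoef i k) = 0).
  apply: uniform_eq0; apply: uniform_add; apply: uniform_sum_scale => j.
    by move=> p g; apply: (ht j _ (fun a => g (inl a))).
  exact: uniform_var.
have [phi pE] := uniform_all (fun=> True) ui f.
by exists phi => N v; rewrite pE; split=> h i; [rewrite addr0|move=> _];
  have := h i; rewrite ?addr0; apply.
Qed.

End Systems.

(** * Covering a pp-set by pp-sets *)

Section DirectSumCoordinates.
Variables (R : pzRingType) (M : lmodType R^c).
Local Notation N := (aleph0_sum M).

Lemma coord0 l : (0 : N) l = 0.
Proof. by []. Qed.

Lemma coordD (x y : N) l : (x + y) l = x l + y l.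
Proof. by []. Qed.

Lemma coordN (x : N) l : (- x) l = - x l.
Proof. by []. Qed.

Lemma coord_sum_scale (I : finType) (x : I -> N) (r : I -> R) l :
  (\sum_i rscale (x i) (r i)) l = \sum_i rscale (x i l) (r i).
Proof.
have coordZ (y : N) a : rscale y a l = rscale (y l) a by [].
by elim/big_rec2: _ => [|i y u _ <-]; rewrite ?coord0 ?coordD ?coordZ.
Qed.

Lemma coord_inj (x y : N) : (forall l, x l = y l) -> x = y.
Proof. by move=> xy; apply/val_inj/funext. Qed.

Lemma coord_bounded (x : N) : exists b, forall l, (b <= l)%N -> x l = 0.
Proof.
have /asboolP/finite_seqP[s sE] := valP x.
exists (\max_(l <- s) l.+1)%N => l bl; apply: contrapT => nz.
have ls : l \in s by have : [set i | x i <> 0] l by []; rewrite sE.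
by move: (leq_trans (leq_bigmax_seq (F := S) _ ls isT) bl); rewrite ltnn.
Qed.

Lemma pp_sol0_coord n (S : pp_system R n) (x : 'I_n -> N) l :
  pp_sol0 S x -> pp_sol0 S (fun j => x j l).
Proof.
move=> [y hy]; exists (fun k => y k l) => i.
by have /(congr1 (fun z : N => z l)) := hy i; rewrite !coordD !coord_sum_scale coord0.
Qed.

Section Spread.
Variables (I : finType) (b : nat).

Definition spread_fun (g : I -> M) (l : nat) : M :=
  if [pick i : I | l == (b + enum_rank i)%N] is Some i then g i else 0.

Lemma spread_support g : spread_fun g \in @finite_support R M.
Proof.
apply/asboolP/(@sub_finite_set _ _ [set` iota b #|I|]); last exact: finite_seq.
rewrite /spread_fun => l /=; case: pickP => [i /eqP-> _|//].
by rewrite mem_iota leq_addr ltn_add2l ltn_ord.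
Qed.

Definition spread g : N := Aleph0Sum (spread_support g).

Lemma spread_rank g i : spread g (b + enum_rank i)%N = g i.
Proof.
rewrite /= /spread_fun; case: pickP => [i' /eqP/addnI/ord_inj/enum_rank_inj-> //|].
by move/(_ i); rewrite eqxx.
Qed.

Lemma pp_sol0_spread n (S : pp_system R n) (g : I -> 'I_n -> M) :
  (forall i, pp_sol0 S (g i)) -> pp_sol0 S (fun j => spread (g ^~ j)).
Proof.
move=> /choice[y hy]; exists (fun k => spread (y ^~ k)) => e.
apply: coord_inj => l; rewrite !coordD !coord_sum_scale !coord0 /= /spread_fun.
case: pickP => [i _|_]; first exact: hy.
by rewrite !big1 ?addr0 // => ? _; rewrite rscale0l.
Qed.

End Spread.

(* Place a solution [g i] of [S] that is not one of [T i] at a coordinate beyond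
   the supports of all the [x i]. *)
Lemma pp_sol0_avoid_sum (I : finType) n (S : pp_system R n)
    (T : I -> pp_system R n) (Q : I -> Prop) :
  (forall i, Q i -> ~ (@pp_sol0 _ _ S M `<=` @pp_sol0 _ _ (T i) M)) ->
  forall x : I -> 'I_n -> N, exists2 y, pp_sol0 S y &
    forall i, Q i -> ~ pp_sol0 (T i) (fun j => y j - x i j).
Proof.
move=> ST x.
have /choice[g hg] i : exists g : 'I_n -> M, pp_sol0 S g /\
    (Q i -> ~ pp_sol0 (T i) g).
  have [Qi|nQi] := pselect (Q i); last first.
    exists (fun=> 0); split=> //; exists (fun=> 0) => e.
    by rewrite !big1 ?addr0 // => ? _; rewrite rscale0l.
  by have /existsNP[g /not_implyP[Sg Tg]] := ST i Qi; exists g; split.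
have /choice[c hc] (p : I * 'I_n) := coord_bounded (x p.1 p.2).
pose b := (\max_p c p)%N.
exists (fun j => spread b (g ^~ j)).
  by apply: pp_sol0_spread => i; case: (hg i).
move=> i Qi /(@pp_sol0_coord _ _ _ (b + enum_rank i)%N).
case: (hg i) => _ /(_ Qi); congr (~ pp_sol0 _ _).
apply: funext => j; rewrite coordD coordN spread_rank (hc (i, j)) ?subr0 //.
by rewrite (leq_trans _ (leq_addr _ _)) // /b (leq_bigmax (i, j)).
Qed.

Lemma pp_sol0_avoid (hM : Th_eq_Th_aleph0 M) (I : finType) n
    (S : pp_system R n) (T : I -> pp_system R n) (Q : I -> Prop) :
  (forall i, Q i -> ~ (@pp_sol0 _ _ S M `<=` @pp_sol0 _ _ (T i) M)) ->
  forall x : I -> 'I_n -> M, exists2 y, pp_sol0 S y &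
    forall i, Q i -> ~ pp_sol0 (T i) (fun j => y j - x i j).
Proof.
move=> ST.
pose P (K : lmodType R^c) (_ : void -> K) := ~ exists x : I * 'I_n -> K,
  ~ exists y : 'I_n -> K, pp_sol0 S y /\
    forall i, Q i -> ~ pp_sol0 (T i) (fun j => y j - x (i, j)).
have uP : uniform_formula P.
  apply: uniform_not.
  apply: (@uniform_exists _ _ _ (fun K (u : void + I * 'I_n -> K) =>
    ~ exists y : 'I_n -> K, pp_sol0 S y /\
      forall i, Q i -> ~ pp_sol0 (T i) (fun j => y j - u (inr (i, j))))).
  apply: uniform_not.
  apply: (@uniform_exists _ _ _ (fun K (u : (void + I * 'I_n) + 'I_n -> K) =>
    pp_sol0 S (fun j => u (inr j)) /\
    forall i, Q i ->
      ~ pp_sol0 (T i) (fun j => u (inr j) - u (inl (inr (i, j)))))).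
  apply: uniform_and.
    by apply: (uniform_pp_sol0 _ (t := fun j K u => u (inr j))) => j; apply: uniform_var.
  apply: uniform_all => i; apply: uniform_not.
  apply: (uniform_pp_sol0 _ (t := fun j K u => u (inr j) - u (inl (inr (i, j))))) => j.
  by apply: uniform_sub; apply: uniform_var.
have PM : P M (fun=> 0).
  apply: (uniform_sentence uP (esym hM)) => -[x]; apply.
  by have [y Sy Ty] := pp_sol0_avoid_sum ST (fun i j => x (i, j)); exists y.
move=> x; have [y [Sy Ty]] : exists y : 'I_n -> M, pp_sol0 S y /\
    forall i, Q i -> ~ pp_sol0 (T i) (fun j => y j - x i j).
  by apply: contrapT => ny; apply: PM; exists (fun p => x p.1 p.2).
by exists y.
Qed.

End DirectSumCoordinates.

Section Cover.
Variables (R : pzRingType) (M : lmodType R^c).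

Lemma pp_set_affine n (X : set ('I_n -> M)) (x y z : 'I_n -> M) :
  pp_set X -> X x -> X y -> X z -> X (fun j => x j - y j + z j).
Proof.
move=> /pp_setP[S [c ->]] Xx Xy Xz; apply/(pp_sol_coset _ Xz).
have := (pp_sol_coset x Xy).1 Xx; congr pp_sol0.
by apply: funext => j; rewrite addrK.
Qed.

Lemma pp_set_cover (hM : Th_eq_Th_aleph0 M) n (F : set ('I_n -> M))
    (s : seq (set ('I_n -> M))) :
  pp_set F -> F !=set0 ->
  (forall G, G \in s -> pp_set G) ->
  (forall G, G \in s -> ~ (F `<=` G)) ->
  exists2 x, F x & forall G, G \in s -> ~ G x.
Proof.
move=> ppF F0 pps nFs; have /pp_setP[S [c FE]] := ppF; case: F0 => x0 Fx0.
pose I := 'I_(size s); pose G (i : I) := nth set0 s i.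
have Gs i : G i \in s by rewrite mem_nth.
have /choice[T hT] i : exists T : pp_system R n, forall z, G i z ->
    forall x, G i x <-> pp_sol0 T (fun j => x j - z j).
  have /pp_setP[T [d GE]] := pps _ (Gs i).
  by exists T => z Gz x; rewrite GE; apply: pp_sol_coset; rewrite -GE.
pose Q i := F `&` G i !=set0.
have /choice[z hz] i : exists z, Q i -> F z /\ G i z.
  by have [[z]|nQ] := pselect (Q i); [exists z|exists x0].
have FP w : F w -> forall x, F x <-> pp_sol0 S (fun j => x j - w j).
  by rewrite FE => Fw x; apply: pp_sol_coset.
have [i Qi ST|y Sy hy] := @pp_sol0_avoid _ _ hM _ _ S T Q _
    (fun i j => z i j - x0 j).
  apply: (nFs _ (Gs i)) => x Fx; have [Fz Gz] := hz i Qi.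
  by apply/(hT i _ Gz); apply: ST; apply/FP.
exists (fun j => y j + x0 j).
  by apply/(FP _ Fx0); congr pp_sol0: Sy; apply: funext => j; rewrite addrK.
move=> _ /(nthP set0)[i si <-] Gy; pose o := Ordinal si.
have Qo : Q o.
  exists (fun j => y j + x0 j); split=> //.
  by apply/(FP _ Fx0); congr pp_sol0: Sy; apply: funext => j; rewrite addrK.
have [Fz Gz] := hz o Qo; apply: (hy o Qo).
have := (hT o _ Gz _).1 Gy; congr pp_sol0; apply: funext => j.
by rewrite opprB addrA.
Qed.

End Cover.

Section PPClosure.
Variables (R : pzRingType) (M : lmodType R^c).

Lemma rscaleB (N : lmodType R^c) (x : N) r r' :
  rscale x (r - r') = rscale x r - rscale x r'.
Proof. exact: scalerBl. Qed.

Lemma rscaleD (N : lmodType R^c) (x : N) r r' :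
  rscale x (r + r') = rscale x r + rscale x r'.
Proof. exact: scalerDl. Qed.

Lemma rscale_delta (N : lmodType R^c) n (x : 'I_n -> N) i :
  \sum_j rscale (x j) (j == i)%:R = x i.
Proof.
rewrite (bigD1 i) //= eqxx big1 ?addr0; first exact: scale1r.
by move=> j /negPf->; exact: scale0r.
Qed.

Lemma pp_set_system n (E W : finType) (r : E -> 'I_n -> R) (s : E -> W -> R)
    (c : E -> M) :
  pp_set [set x | exists y : W -> M, forall e,
    \sum_j rscale (x j) (r e j) + \sum_w rscale (y w) (s e w) + c e = 0].
Proof.
exists #|W|, #|E|, (fun i => r (enum_val i)),
  (fun i k => s (enum_val i) (enum_val k)), (fun i => c (enum_val i)).
have sumE (y : W -> M) e : \sum_(k < #|W|) rscale (y (enum_val k)) (s e (enum_val k))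
    = \sum_w rscale (y w) (s e w).
  rewrite (reindex enum_rank) /=; last exact/onW_bij/enum_rank_bij.
  by apply: eq_bigr => w _; rewrite enum_rankK.
apply/seteqP; split=> x [y hy].
  by exists (y \o enum_val) => i; rewrite /= sumE.
exists (y \o enum_rank) => e; have := hy (enum_rank e).
rewrite enum_rankK -sumE; congr (_ + _ + _ = 0).
by apply: eq_bigr => k _; rewrite /= enum_valK.
Qed.

Lemma pp_setI n (X Y : set ('I_n -> M)) :
  pp_set X -> pp_set Y -> pp_set (X `&` Y).
Proof.
move=> [m1 [t1 [r1 [s1 [c1 ->]]]]] [m2 [t2 [r2 [s2 [c2 ->]]]]].
pose s (e : 'I_t1 + 'I_t2) (w : 'I_m1 + 'I_m2) : R :=
  match e, w with inl i, inl k => s1 i k | inr i, inr k => s2 i k | _, _ => 0 end.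
have := pp_set_system (fjoin r1 r2) s (fjoin c1 c2); congr pp_set.
have sum0 (I : finType) (y : I -> M) : \sum_i rscale (y i) 0 = 0.
  by rewrite big1 // => i _; exact: scale0r.
apply/seteqP; split=> x /=.
  move=> [y hy]; split; [exists (y \o inl)|exists (y \o inr)] => i.
    by have := hy (inl i); rewrite big_sumType /= sum0 addr0.
  by have := hy (inr i); rewrite big_sumType /= sum0 add0r.
move=> [[y1 h1] [y2 h2]]; exists (fjoin y1 y2) => -[i|i];
  by rewrite big_sumType /= sum0 ?addr0 ?add0r.
Qed.

Lemma pp_set_fix n (E : finType) (g : E -> 'I_n) (d : E -> M) :
  pp_set [set x | forall e, x (g e) = d e].
Proof.
have := pp_set_system (fun e j => (j == g e)%:R) (fun _ (_ : void) => 0 : R)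
  (fun e => - d e).
congr pp_set; apply/seteqP; split=> x /= => [[y hy] e|hx].
  apply/eqP; rewrite -subr_eq0; apply/eqP; have := hy e.
  by rewrite rscale_delta big1 ?addr0 // => -[].
exists (fun=> 0) => e; rewrite rscale_delta hx big1 ?addr0 ?subrr // => -[].
Qed.

Lemma pp_setT n : pp_set [set: 'I_n -> M].
Proof.
have := pp_set_fix (n := n) (fun v : void => match v with end) (fun=> 0).
by congr pp_set; apply/seteqP; split=> // x _ [].
Qed.

Lemma pp_set1 n (x : 'I_n -> M) : pp_set [set x].
Proof.
have := pp_set_fix id x; congr pp_set.
by apply/seteqP; split=> y /= => [yx|->//]; apply: funext.
Qed.

Lemma pp_set_vcat n k (X : set ('I_(n + k) -> M)) (a : 'I_k -> M) :
  pp_set X -> pp_set [set x | X (vcat x a)].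
Proof.
move=> [m [t [r [s [c ->]]]]].
exists m, t, (fun i j => r i (lshift k j)), s,
  (fun i => \sum_j rscale (a j) (r i (rshift n j)) + c i).
have sumE x i : \sum_j rscale (vcat x a j) (r i j) =
    \sum_j rscale (x j) (r i (lshift k j)) + \sum_j rscale (a j) (r i (rshift n j)).
  by rewrite big_split_ord; congr (_ + _); apply: eq_bigr => j _;
    rewrite ?vcat_lshift ?vcat_rshift.
by apply/seteqP; split=> x [y hy]; exists y => i; have := hy i;
  rewrite sumE addrA [X in X + _]addrAC.
Qed.

Definition proj n (X : set ('I_n.+1 -> M)) : set ('I_n -> M) :=
  [set v | exists x, X (vcons x v)].

Lemma pp_set_proj n (X : set ('I_n.+1 -> M)) : pp_set X -> pp_set (proj X).
Proof.
move=> [m [t [r [s [c ->]]]]].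
exists m.+1, t, (fun i j => r i (lift ord0 j)),
  (fun i => vcons (r i ord0) (s i)), c.
have sumE (p : nat) (u : M) (v : 'I_p -> M) (f : 'I_p.+1 -> R) :
    \sum_j rscale (vcons u v j) (f j) =
    rscale u (f ord0) + \sum_j rscale (v j) (f (lift ord0 j)).
  rewrite big_ord_recl vcons_ord0; congr (_ + _).
  by apply: eq_bigr => j _; rewrite vcons_lift.
have sum_vcons (u : M) (y : 'I_m -> M) i :
    \sum_k rscale (vcons u y k) (vcons (r i ord0) (s i) k) =
    rscale u (r i ord0) + \sum_k rscale (y k) (s i k).
  rewrite sumE vcons_ord0; congr (_ + _).
  by apply: eq_bigr => k _; rewrite vcons_lift.
apply/seteqP; split=> v.
  move=> [u [y hy]]; exists (vcons u y) => i; rewrite -[RHS](hy i).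
  by rewrite sum_vcons sumE addrCA addrA.
move=> [y hy]; exists (y ord0), (y \o lift ord0) => i; rewrite -[RHS](hy i).
by rewrite -[in RHS](vcons_eta y) sum_vcons sumE addrCA addrA.
Qed.

Lemma teval_linear n (t : term R n) : exists a : 'I_n -> R,
  forall v : 'I_n -> M, teval v t = \sum_j rscale (v j) (a j).
Proof.
elim: t => [i||t1 [a ha] t2 [b hb]|t [a ha]|t [a ha] r].
- by exists (fun j => (j == i)%:R) => v; rewrite rscale_delta.
- by exists (fun=> 0) => v; rewrite big1 // => j _; exact: scale0r.
- exists (fun j => a j + b j) => v; rewrite /= ha hb -big_split.
  by apply: eq_bigr => j _; rewrite rscaleD.
- exists (fun j => 0 - a j) => v; rewrite /= ha -sumrN.
  by apply: eq_bigr => j _; rewrite rscaleB [rscale _ 0]scale0r sub0r.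
- exists (fun j => a j * r) => v; rewrite /= ha /rscale scaler_sumr.
  by apply: eq_bigr => j _; rewrite scalerA.
Qed.

Lemma pp_set_eq n (t u : term R n) :
  pp_set [set v : 'I_n -> M | teval v t = teval v u].
Proof.
have [a ha] := teval_linear t; have [b hb] := teval_linear u.
have := pp_set_system (fun (_ : unit) j => a j - b j) (fun _ (_ : void) => 0 : R)
  (fun=> 0).
have E (v : 'I_n -> M) : \sum_j rscale (v j) (a j - b j) = teval v t - teval v u.
  by rewrite ha hb -sumrB; apply: eq_bigr => j _; rewrite rscaleB.
congr pp_set; apply/seteqP; split=> v /=.
  move=> [y /(_ tt)]; rewrite E [\sum_(w : void) _]big1 ?addr0; last by case.
  by move/eqP; rewrite subr_eq0 => /eqP.
move=> vE; exists (fun=> 0) => _; rewrite E vE subrr big1 ?addr0 //; by case.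
Qed.

End PPClosure.

(** * Elimination of quantifiers *)

Section BooleanCombinations.
Variables (R : pzRingType) (M : lmodType R^c).

Definition decides T (S : set (set T)) (X : set T) : Prop :=
  forall x y, (forall G, S G -> G x <-> G y) -> X x -> X y.

Definition pp_boolean n (X : set ('I_n -> M)) : Prop :=
  exists2 s : seq (set ('I_n -> M)),
    (forall G, G \in s -> pp_set G) & decides [set` s] X.

Lemma pp_boolean_pp n (X : set ('I_n -> M)) : pp_set X -> pp_boolean X.
Proof.
move=> ppX; exists [:: X] => [G|x y]; first by rewrite inE => /eqP->.
by move/(_ X); rewrite /= inE eqxx => /(_ isT)[].
Qed.

Lemma pp_boolean0 n : pp_boolean (set0 : set ('I_n -> M)).
Proof. by exists [::]. Qed.

Lemma pp_booleanC n (X : set ('I_n -> M)) : pp_boolean X -> pp_boolean (~` X).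
Proof.
move=> [s pps sX]; exists s => // x y xy nXx Xy; apply: nXx.
by apply: sX Xy => G Gs; split=> /(xy G Gs).
Qed.

Lemma pp_booleanI n (X Y : set ('I_n -> M)) :
  pp_boolean X -> pp_boolean Y -> pp_boolean (X `&` Y).
Proof.
move=> [s pps sX] [t ppt tY]; exists (s ++ t) => [G|x y xy [Xx Yx]].
  by rewrite mem_cat => /orP[/pps|/ppt].
split; [apply: sX Xx|apply: tY Yx] => G /= Gin; apply: xy;
  by rewrite /= mem_cat Gin ?orbT.
Qed.

Lemma pp_booleanU n (X Y : set ('I_n -> M)) :
  pp_boolean X -> pp_boolean Y -> pp_boolean (X `|` Y).
Proof.
move=> bX bY; rewrite -[_ `|` _]setCK setCU.
by apply/pp_booleanC/pp_booleanI; apply: pp_booleanC.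
Qed.

Lemma pp_boolean_exists n (I : eqType) (s : seq I) (F : I -> set ('I_n -> M)) :
  (forall i, i \in s -> pp_boolean (F i)) ->
  pp_boolean [set x | exists2 i, i \in s & F i x].
Proof.
elim: s => [|i s IHs] Fs.
  by rewrite (_ : [set _ | _] = set0); [exact: pp_boolean0|apply/seteqP; split=> x //= []].
rewrite (_ : [set _ | _] = F i `|` [set x | exists2 i, i \in s & F i x]).
  apply: pp_booleanU; first by apply: Fs; rewrite mem_head.
  by apply: IHs => j js; apply: Fs; rewrite inE js orbT.
apply/seteqP; split=> x /=.
  by move=> [j]; rewrite inE => /orP[/eqP->|js Fj]; [left|right; exists j].
move=> [Fi|[j js Fj]]; first by exists i; rewrite ?mem_head.
by exists j; rewrite // inE js orbT.
Qed.

Lemma pp_boolean_forall n (I : eqType) (s : seq I) (F : I -> set ('I_n -> M)) :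
  (forall i, i \in s -> pp_boolean (F i)) ->
  pp_boolean [set x | forall i, i \in s -> F i x].
Proof.
move=> Fs; rewrite -[X in pp_boolean X]setCK; apply: pp_booleanC.
rewrite (_ : ~` _ = [set x | exists2 i, i \in s & (~` F i) x]).
  by apply: pp_boolean_exists => i /Fs; apply: pp_booleanC.
apply/seteqP; split=> x /=; last by move=> [i si nF] /(_ i si).
by move=> /existsNP[i /not_implyP[si nFi]]; exists i.
Qed.

Fixpoint meets T (s : seq (set T)) : seq (set T) :=
  if s is G :: s' then meets s' ++ [seq G `&` Y | Y <- meets s'] else [:: setT].

Lemma meetsT T (s : seq (set T)) : setT \in meets s.
Proof. by elim: s => [|G s IHs] /=; rewrite ?mem_head // mem_cat IHs. Qed.

Lemma sub_meets T (s : seq (set T)) : {subset s <= meets s}.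
Proof.
elim: s => [//|G s IHs] X /=; rewrite inE mem_cat => /orP[/eqP->|/IHs->//].
apply/orP; right; rewrite -[G in G \in _]setIT; apply: map_f; exact: meetsT.
Qed.

Lemma meetsI T (s : seq (set T)) (X Y : set T) :
  X \in meets s -> Y \in meets s -> X `&` Y \in meets s.
Proof.
elim: s X Y => [|G s IHs] X Y /=.
  by rewrite !mem_seq1 => /eqP-> /eqP->; rewrite setIT.
rewrite !mem_cat => /orP[Xs|/mapP[X' X's ->]] /orP[Ys|/mapP[Y' Y's ->]];
  apply/orP; [left; exact: IHs|right..].
- by rewrite setICA; apply: map_f; apply: IHs.
- by rewrite -setIA; apply: map_f; apply: IHs.
- by rewrite setIACA setIid; apply: map_f; apply: IHs.
Qed.

Lemma pp_boolean_nest n (X : set ('I_n -> M)) : pp_boolean X ->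
  exists D : {fset set ('I_n -> M)}, [/\ nest D, setT \in D & decides [set` D] X].
Proof.
move=> [s pps sX]; exists [fset G in meets s]%fset.
have inD G : (G \in [fset G in meets s]%fset) = (G \in meets s) by rewrite !inE.
split; [split|by rewrite inD meetsT|].
- move=> G /=; rewrite inD; elim: s pps {sX inD} G => [|H s IHs] pps G /=.
    by rewrite inE => /eqP->; exact: pp_setT.
  have {}IHs Y : Y \in meets s -> pp_set Y.
    by apply: IHs => Z Zs; apply: pps; rewrite inE Zs orbT.
  rewrite mem_cat => /orP[/IHs//|/mapP[Y /IHs ppY ->]].
  by apply: pp_setI => //; apply: pps; rewrite mem_head.
- by move=> G H /=; rewrite !inD; exact: meetsI.
- by move=> x y xy; apply: sX => G /= Gs; apply: xy; rewrite /= inD sub_meets.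
Qed.

End BooleanCombinations.

Section Cores.
Variables (R : pzRingType) (M : lmodType R^c) (n : nat).
Implicit Types (X F G : set ('I_n -> M)) (D : {fset set ('I_n -> M)}).

Lemma coreP D F x :
  core D F x <-> F x /\ forall G, G \in D -> G x -> F `<=` G.
Proof.
split=> [[Fx nGx]|[Fx leF]]; split=> //.
  move=> G GD Gx; apply: contrapT => nFG; apply: nGx; exists G => //; split=> //.
  by split=> [y []//|FGF]; apply: nFG => y /FGF[].
by move=> [G [GD [_ nFG]] Gx]; apply: nFG => y Fy; split=> //; exact: (leF G).
Qed.

Lemma core_exists D x G :
  nest D -> G \in D -> G x -> exists2 F, F \in D & core D F x.
Proof.
move=> [_ DI] GD Gx.
have [F [FD Fx leF]] : exists F, [/\ F \in D, F x &
    forall H, H \in enum_fset D -> H x -> F `<=` H].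
  have : {subset enum_fset D <= D} by [].
  elim: (enum_fset D) => [|H s IHs] sD; first by exists G.
  have [|F [FD Fx leF]] := IHs; first by move=> K Ks; apply: sD; rewrite inE Ks orbT.
  have HD : H \in D by apply: sD; rewrite mem_head.
  have [Hx|nHx] := pselect (H x).
    exists (F `&` H); split=> // [|K]; first exact: DI.
    by rewrite inE => /orP[/eqP-> _ y []//|Ks Kx y [Fy _]]; exact: (leF K).
  exists F; split=> // K; rewrite inE => /orP[/eqP->//|]; exact: leF.
by exists F => //; apply/coreP.
Qed.

Lemma decides_core D X F x y :
  decides [set` D] X -> core D F x -> core D F y -> X x -> X y.
Proof.
move=> dX /coreP[Fx leFx] /coreP[Fy leFy]; apply: dX => G /= GD.
by split=> [/(leFx G GD)|/(leFy G GD)]; apply.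
Qed.

End Cores.

Section QuantifierElimination.
Variables (R : pzRingType) (M : lmodType R^c).
Hypothesis hM : Th_eq_Th_aleph0 M.

Lemma pp_boolean_proj_core n (D : {fset set ('I_n.+1 -> M)}) F :
  nest D -> F \in D -> pp_boolean (proj (core D F)).
Proof.
move=> [ppD DI] FD; have ppF : pp_set F by exact: ppD.
pose line v : set ('I_n.+1 -> M) := [set u | forall j, u (lift ord0 j) = v j].
have lineP v u : line v u -> vcons (u ord0) v = u.
  by move=> uv; rewrite -[RHS]vcons_eta; congr vcons; apply: funext => j; rewrite /= uv.
have line_vcons v x : line v (vcons x v) by move=> j; rewrite vcons_lift.
have ppFline v : pp_set (F `&` line v) by apply: pp_setI => //; exact: pp_set_fix.
pose Z G : set ('I_n -> M) := [set v | proj F v /\ F `&` line v `<=` G].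
pose s := [seq G <- enum_fset D | ~~ `[< F `<=` G >]].
have memsP G : G \in s <-> G \in D /\ ~ F `<=` G.
  by rewrite mem_filter; split=> [/andP[/asboolPn]|[GD nFG]];
    [split|apply/andP; split=> //; apply/asboolPn].
have -> : proj (core D F) = proj F `&` [set v | forall G, G \in s -> (~` Z G) v].
  apply/seteqP; split=> v.
    move=> [x /coreP[Fx leF]]; split; first by exists x.
    by move=> G /memsP[GD nFG] [_ FG]; apply: nFG; apply: leF => //; apply: FG.
  move=> [[x Fx] nZ].
  have [||G /memsP[GD _]|G /[dup] Gs /nZ nZG FG|u [Fu vu] nsu] :=
      @pp_set_cover _ _ hM _ (F `&` line v) s.
  - exact: ppFline.
  - by exists (vcons x v).
  - exact: ppD.
  - by apply: nZG; split=> //; exists x.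
  exists (u ord0); rewrite lineP //; apply/coreP; split=> // G GD Gu.
  by apply: contrapT => nFG; apply: (nsu G) => //; apply/memsP.
apply: pp_booleanI; first exact/pp_boolean_pp/pp_set_proj.
apply: pp_boolean_forall => G /memsP[GD _]; apply: pp_booleanC.
have [[v0 [[x0 Fx0] Zv0]]|nZ] := pselect (Z G !=set0); last first.
  rewrite (_ : Z G = set0); first exact: pp_boolean0.
  by apply/seteqP; split=> // v Zv; apply: nZ; exists v.
(* All the nonempty fibres of [F] are translates of one another, and so are the
   nonempty fibres of [F `&` G]; hence the fibres of [F] over points of
   [proj (F `&` G)] are contained in [G] as soon as one is. *)
have -> : Z G = proj (F `&` G).
  apply/seteqP; split=> v.
    by move=> [[x Fx] FG]; exists x; split=> //; apply: FG.
  move=> [x [Fx Gx]]; split; first by exists x.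
  move=> u [Fu vu]; have Gx0 : G (vcons x0 v0) by apply: Zv0.
  have Gz : G (fun j => u j - vcons x v j + vcons x0 v0 j).
    apply: Zv0; split; first exact: pp_set_affine.
    by move=> j; rewrite !vcons_lift vu subrr add0r.
  have := pp_set_affine (ppD _ GD) Gz Gx0 Gx; congr G.
  by apply: funext => j; rewrite addrK subrK.
exact/pp_boolean_pp/pp_set_proj/pp_setI/ppD.
Qed.

Lemma pp_boolean_proj n (X : set ('I_n.+1 -> M)) :
  pp_boolean X -> pp_boolean (proj X).
Proof.
move=> /pp_boolean_nest[D [nD DT dX]].
pose s := [seq F <- enum_fset D | `[< core D F `<=` X >]].
rewrite (_ : proj X = [set v | exists2 F, F \in s & proj (core D F) v]).
  by apply: pp_boolean_exists => F; rewrite mem_filter => /andP[_];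
    exact: pp_boolean_proj_core.
apply/seteqP; split=> v [].
  move=> x Xx; have [//|F FD Fx] := core_exists nD DT (x := vcons x v).
  exists F; last by exists x.
  rewrite mem_filter FD andbT; apply/asboolP => y Fy.
  exact: decides_core dX Fx Fy Xx.
by move=> F; rewrite mem_filter => /andP[/asboolP FX _] [x /FX Xx]; exists x.
Qed.

Lemma pp_boolean_sat n (phi : formula R n) :
  pp_boolean [set v : 'I_n -> M | sat phi v].
Proof.
elim: phi => [{}n t u|{}n f IHf|{}n f IHf g IHg|{}n f IHf].
- exact/pp_boolean_pp/pp_set_eq.
- exact: pp_booleanC.
- exact: pp_booleanI.
- exact: pp_boolean_proj.
Qed.

Lemma definable_pp_boolean n (X : set ('I_n -> M)) :
  definable X -> pp_boolean X.
Proof.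
move=> [k [phi [a ->]]]; have [s pps sphi] := pp_boolean_sat phi.
exists [seq [set x | G (vcat x a)] | G <- s].
  by move=> _ /mapP[G Gs ->]; apply: pp_set_vcat; exact: pps.
move=> x y xy; apply: sphi => G /= Gs.
by apply: (xy [set x | G (vcat x a)]); exact: map_f.
Qed.

End QuantifierElimination.

Section Partitions.
Variables (R : pzRingType) (M : lmodType R^c) (n : nat).
Implicit Types (X F G : set ('I_n -> M)) (D : {fset set ('I_n -> M)}).

Lemma maximal_above T (B : {fset set T}) (G : set T) : G \in B ->
  exists H, [/\ H \in B, G `<=` H & forall K, K \in B -> H `<=` K -> H = K].
Proof.
move=> GB.
have [H [HB GH maxH]] : exists H, [/\ H \in B, G `<=` H &
    forall K, K \in enum_fset B -> H `<=` K -> H = K].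
  have : {subset enum_fset B <= B} by [].
  elim: (enum_fset B) => [|K s IHs] sB; first by exists G; split=> //; exact: subset_refl.
  have [|H [HB GH maxH]] := IHs; first by move=> L Ls; apply: sB; rewrite inE Ls orbT.
  have [HK|nHK] := pselect (H `<=` K).
    exists K; split; [by apply: sB; rewrite mem_head|exact: subset_trans HK|].
    move=> L; rewrite inE => /orP[/eqP->//|Ls KL].
    have HL : H = L by apply: maxH => //; apply: subset_trans KL.
    by apply/seteqP; split=> //; rewrite -HL.
  by exists H; split=> // L; rewrite inE => /orP[/eqP-> /nHK//|]; exact: maxH.
by exists H.
Qed.

Definition core_below D F : {fset set ('I_n -> M)} :=
  [fset G in D | `[< (G !=set0)%classic /\ (G `<` F)%classic >]]%fset.

Definition core_block D F : block_data M n :=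
  (F, [fset G in core_below D F |
        `[< forall H, H \in core_below D F -> (G `<=` H)%classic -> G = H >]]%fset).

Lemma core_belowP D F G :
  G \in core_below D F <-> [/\ G \in D, G !=set0 & G `<` F].
Proof.
rewrite !inE /=; split=> [/andP[GD /asboolP[]]//|[GD G0 GF]].
by rewrite GD; apply/asboolP.
Qed.

Lemma core_blockP D F G : G \in (core_block D F).2 <->
  G \in core_below D F /\ forall H, H \in core_below D F -> G `<=` H -> G = H.
Proof.
rewrite /core_block /= in_fset !inE /=; split=> [/andP[GB /asboolP]//|[GB maxG]].
by rewrite GB; apply/asboolP.
Qed.

Lemma block_set_core D F : nest D -> F \in D ->
  block_set (core_block D F) = core D F.
Proof.
move=> [_ DI] FD; apply/seteqP; split=> x.
  move=> [Fx nx]; apply/coreP; split=> // G GD Gx; apply: contrapT => nFG.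
  have GFB : G `&` F \in core_below D F.
    apply/core_belowP; split; [exact: DI|by exists x|].
    by split=> [y []//|FGF]; apply: nFG => y /FGF[].
  have [H [HB GH maxH]] := maximal_above GFB.
  by apply: nx; exists H; [apply/core_blockP|apply: GH].
move=> /coreP[Fx leF]; split=> // -[G /core_blockP[/core_belowP[GD _ [_ nFG]] _] Gx].
by apply: nFG; apply: leF.
Qed.

Lemma pp_boolean_block_partition X :
  pp_boolean X -> exists p, block_partition X p.
Proof.
move=> /pp_boolean_nest[D [nD DT dX]]; have [ppD DI] := nD.
pose p := [fset core_block D F | F in positive_part X D]%fset.
have posP F : F \in positive_part X D ->
    [/\ F \in D, F !=set0 & core D F `<=` X].
  by rewrite !inE /= => /andP[FD /asboolP[F0 FX]].
exists p; split.
- move=> _ /imfsetP[F /posP[FD F0 _] ->]; split=> //=; first exact: ppD.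
    move=> G /core_blockP[/core_belowP[GD G0 GF] _]; split=> //; exact: ppD.
  by move=> G H /core_blockP[_ maxG] /core_blockP[HB _]; exact: maxG.
- move=> _ _ /imfsetP[F /posP[FD _ _] ->] /imfsetP[G /posP[GD _ _] ->].
  rewrite !block_set_core // => -[x [/coreP[Fx leF] /coreP[Gx leG]]].
  by congr core_block; apply/seteqP; split; [apply: leF|apply: leG].
- apply/seteqP; split=> x.
    move=> [_ /imfsetP[F /posP[FD _ FX] ->]].
    by rewrite block_set_core //; exact: FX.
  move=> Xx; have [//|F FD Fx] := core_exists nD DT (x := x).
  exists (core_block D F); last by rewrite block_set_core.
  apply/imfsetP; exists F => //; rewrite !inE FD /=; apply/asboolP; split.
    by exists x; case/coreP: Fx.
  by move=> y Fy; exact: decides_core dX Fx Fy Xx.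
Qed.

Definition adapted X D : Prop :=
  [/\ nest D, decides [set` D] X & X `<=` \bigcup_(G in [set` D]) G].

Lemma admissible_adapted X D :
  pp_boolean X -> admissible_nest X D -> adapted X D.
Proof.
move=> bX [nD pD].
have [_ _ XE] : block_partition X (fixed_partition X).
  by apply: xgetPex; exact: pp_boolean_block_partition.
have sub b : b \in fixed_partition X -> [set b.1] `|` [set` b.2] `<=` [set` D].
  move=> bp; apply: subset_trans pD => G bG S [_ genS].
  by apply: genS; exists b.
split=> //.
  move=> x y xy; rewrite -XE => -[b bp [bx nbx]]; exists b => //; split.
    by apply/(xy b.1) => //; apply: (sub b bp); left.
  move=> [G Gb Gy]; apply: nbx; exists G => //.
  by apply/(xy G) => //; apply: (sub b bp); right.
by move=> x; rewrite -XE => -[b bp [bx _]]; exists b.1 => //; apply: (sub b bp); left.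
Qed.

End Partitions.

(** * Generic pp-sets and components *)

Section Components.
Variables (R : pzRingType) (M : lmodType R^c) (n : nat).
Hypothesis hM : Th_eq_Th_aleph0 M.
Implicit Types (X Y F G : set ('I_n -> M)) (D V : {fset set ('I_n -> M)}).

(* For a nest [D] adapted to [X], [positive_part X D] consists of the [F] in [D]
   generic in [X]; genericity itself does not depend on the nest. *)
Definition generic X F : Prop :=
  [/\ pp_set F, F !=set0 & exists s : seq (set ('I_n -> M)),
      [/\ forall G, G \in s -> pp_set G, forall G, G \in s -> ~ F `<=` G
        & F `\` \bigcup_(G in [set` s]) G `<=` X]].

Lemma generic_sub X Y F : X `<=` Y -> generic X F -> generic Y F.
Proof.
move=> XY [ppF F0 [s [pps nFs sX]]]; split=> //; exists s; split=> //.
exact: subset_trans XY.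
Qed.

Lemma generic1 X x : X x -> generic X [set x].
Proof.
move=> Xx; split; [exact: pp_set1|by exists x|exists [::]; split=> //].
by move=> y [-> _].
Qed.

Lemma positive_partP X D F : F \in positive_part X D <->
  [/\ F \in D, F !=set0 & core D F `<=` X].
Proof.
by rewrite !inE /=; split=> [/andP[FD /asboolP[]]//|[FD F0 FX]];
  rewrite FD; apply/asboolP.
Qed.

Definition not_above D F : seq (set ('I_n -> M)) :=
  [seq G <- enum_fset D | ~~ `[< F `<=` G >]].

Lemma not_aboveP D F G : G \in not_above D F <-> G \in D /\ ~ F `<=` G.
Proof.
by rewrite mem_filter; split=> [/andP[/asboolPn]|[GD nFG]];
  [split|apply/andP; split=> //; apply/asboolPn].
Qed.

Lemma core_not_above D F x : F x -> (forall G, G \in not_above D F -> ~ G x) ->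
  core D F x.
Proof.
move=> Fx nG; apply/coreP; split=> // G GD Gx; apply: contrapT => nFG.
by apply: (nG G) => //; apply/not_aboveP.
Qed.

Lemma core_nonempty D F : nest D -> F \in D -> F !=set0 -> core D F !=set0.
Proof.
move=> [ppD _] FD F0.
have [|//|G /not_aboveP[GD _]|G /not_aboveP[]//|x Fx nG] :=
    @pp_set_cover _ _ hM _ F (not_above D F).
- exact: ppD.
- exact: ppD.
- by exists x; apply: core_not_above.
Qed.

Lemma positive_generic X D F :
  nest D -> F \in positive_part X D -> generic X F.
Proof.
move=> [ppD _] /positive_partP[FD F0 FX]; split=> //; first exact: ppD.
exists (not_above D F); split=> [G /not_aboveP[GD _]|G /not_aboveP[]//|x [Fx nG]].
  exact: ppD.
by apply: FX; apply: core_not_above => // G Gs Gx; apply: nG; exists G.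
Qed.

Lemma generic_hull X D F : adapted X D -> generic X F ->
  exists H, [/\ H \in positive_part X D, F `<=` H &
    forall G, G \in D -> F `<=` G -> H `<=` G].
Proof.
move=> [nD dX XD] [ppF F0 [s [pps nFs sX]]]; have [ppD _] := nD.
have [//|//|G|G|x Fx nG] :=
    @pp_set_cover _ _ hM _ F (s ++ not_above D F).
- by rewrite mem_cat => /orP[/pps//|/not_aboveP[GD _]]; exact: ppD.
- by rewrite mem_cat => /orP[/nFs//|/not_aboveP[]].
have Xx : X x.
  by apply: sX; split=> // -[G Gs]; apply: nG; rewrite mem_cat Gs.
have above G : G \in D -> G x -> F `<=` G.
  move=> GD Gx; apply: contrapT => nFG; apply: (nG G) => //.
  by rewrite mem_cat; apply/orP; right; apply/not_aboveP.
have [K KD Kx] := XD _ Xx; have [H HD Hx] := core_exists nD KD Kx.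
have [Hx' leH] := (coreP D H x).1 Hx; exists H; split.
- apply/positive_partP; split=> //; first by exists x.
  by move=> y Hy; exact: decides_core dX Hx Hy Xx.
- exact: above.
- by move=> G GD FG; apply: leH => //; exact: FG.
Qed.

Definition hasse (V : {fset set ('I_n -> M)}) : rel V :=
  [rel F1 F2 : V | arrow F1 F2 || arrow F2 F1].

Lemma hasse_sym V : connect_sym (@hasse V).
Proof. by apply: sym_connect_sym => F G; rewrite /hasse /= orbC. Qed.

Lemma connect_hasse V (F G : V) : val F `<=` val G -> connect (@hasse V) F G.
Proof.
pose between (F G : V) := [set H : V |
  `[< val F `<` val H >] && `[< val H `<` val G >]]%SET.
have [k] := ubnP #|between F G|; elim: k F G => // k IHk F G ltk FG.
have [/val_inj->|neFG] := eqVneq (val F) (val G); first exact: connect0.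
have ltFG : val F `<` val G.
  by split=> // GF; move/eqP: neFG; apply; apply/seteqP.
have [[H [FH HG]]|nH] := pselect (exists H : V, val F `<` val H /\ val H `<` val G);
  last by apply: connect1; apply/orP; left; apply/asboolP.
have Hbetween : H \in between F G by rewrite finset.inE; apply/andP; split; apply/asboolP.
have smaller (F' G' : V) : val F `<=` val F' -> val G' `<=` val G ->
    H \notin between F' G' -> (#|between F' G'| < k)%N.
  move=> FF' GG' nH; rewrite -ltnS; apply: leq_ltn_trans ltk; apply: proper_card.
  apply/properP; split; last by exists H.
  apply/fintype.subsetP => K; rewrite !finset.inE.
  move=> /andP[/asboolP F'K /asboolP KG']; apply/andP; split; apply/asboolP.
    by case: F'K => F'K nKF'; split=> [|KF]; [exact: subset_trans F'K|
      apply: nKF'; exact: subset_trans FF'].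
  by case: KG' => KG' nG'K; split=> [|GK]; [exact: subset_trans GG'|
    apply: nG'K; exact: subset_trans GK].
have nHH : ~~ `[< val H `<` val H >] by apply/asboolPn; exact: properxx.
apply: (connect_trans (y := H)); apply: IHk.
- by apply: smaller => //; [case: HG|rewrite finset.inE (negPf nHH) andbF].
- by case: FH.
- by apply: smaller => //; [case: FH|rewrite finset.inE (negPf nHH)].
- by case: HG.
Qed.

Lemma component_map X D : adapted X D -> X !=set0 ->
  exists c : set ('I_n -> M) -> positive_part X D,
    (forall F G, generic X F -> generic X G -> F `<=` G -> c F = c G) /\
    forall v, exists2 x, X x & c [set x] = fingraph.root (@hasse _) v.
Proof.
move=> aX [x0 Xx0]; have [nD dX XD] := aX; have [ppD _] := nD.
have [H0 [H0pos _ _]] := generic_hull aX (generic1 Xx0).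
have /choice[h hP] F : exists H : positive_part X D, generic X F ->
    F `<=` val H /\ forall G, G \in D -> F `<=` G -> val H `<=` G.
  have [gF|ngF] := pselect (generic X F); last by exists [` H0pos]%fset.
  by have [H [Hpos FH leH]] := generic_hull aX gF; exists [` Hpos]%fset.
have hD (H : positive_part X D) : val H \in D.
  by have /positive_partP[] := valP H.
have hroot F (G : positive_part X D) : generic X F -> F `<=` val G ->
    fingraph.root (@hasse _) (h F) = fingraph.root (@hasse _) G.
  move=> gF FG; apply/(fingraph.rootP (@hasse_sym _)); apply: connect_hasse.
  by have [_] := hP F gF; apply; first exact: hD.
exists (fun F => fingraph.root (@hasse _) (h F)); split.
  move=> F G gF gG FG; apply: hroot => //; have [GhG _] := hP G gG.
  exact: subset_trans GhG.
move=> v; have /positive_partP[vD v0 vX] := valP v.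
have [x vx] := core_nonempty nD vD v0; exists x; first exact: vX.
apply: hroot; first exact/generic1/vX.
by move=> y ->; case/coreP: vx.
Qed.

Lemma connected_constant T X D (c : set ('I_n -> M) -> T) :
  adapted X D -> weak_components (positive_part X D) = 1%N ->
  (forall F G, generic X F -> generic X G -> F `<=` G -> c F = c G) ->
  forall x y, X x -> X y -> c [set x] = c [set y].
Proof.
move=> aX w1 cE x y Xx Xy; have [nD _ _] := aX.
have gV (F : positive_part X D) : generic X (val F).
  exact: positive_generic (valP F).
have hull z : X z -> exists f : positive_part X D, [set z] `<=` val f.
  move=> /generic1/(generic_hull aX)[F [Fpos zF _]].
  by exists [` Fpos]%fset.
have [f xf] := hull x Xx; have [g yg] := hull y Xy.
rewrite (cE _ (val f)) //; last exact: generic1.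
rewrite (cE [set y] (val g)) //; last exact: generic1.
have /connectP[p] : connect (@hasse _) f g.
  apply/(fingraph.rootP (@hasse_sym _)).
  have /card_le1P le1 : (#|[predI fingraph.roots (@hasse (positive_part X D)) & predT]| <= 1)%N.
    by rewrite [X in (X <= _)%N]w1.
  have rin v : fingraph.root (@hasse _) v \in
      [predI fingraph.roots (@hasse (positive_part X D)) & predT].
    by rewrite !inE /= roots_root //; exact: (@hasse_sym _).
  by have /(_ (fingraph.root (@hasse _) g)) := le1 _ (rin f); rewrite rin inE => /esym/eqP->.
elim: p f {xf} => [|k p IHp] f /=; first by move=> _ ->.
move=> /andP[fk pk] gE; rewrite -(IHp k) //.
case/orP: fk => /asboolP[[fk _] _]; first exact: cE fk.
by apply/esym; exact: cE fk.
Qed.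

End Components.

Theorem theorem6p4p6 (R : pzRingType) (M : lmodType R^c)
    (hM : Th_eq_Th_aleph0 M) (n : nat) (hn : (1 <= n)%N) (m : nat)
    (A : set ('I_n -> M)) (B : 'I_m -> set ('I_n -> M))
    (hA : connected_definable A)
    (hB : forall i : 'I_m, connected_definable (B i))
    (hlambda : lambda (\bigcup_i B i) = m)
    (hAB : A `<=` \bigcup_i B i) :
  exists! i : 'I_m, A `<=` B i.
Proof.
set X := \bigcup_i B i in hlambda hAB *.
have BX i : B i `<=` X by move=> x Bx; exists i.
have [dA [a Aa] [DA admA wA]] := hA.
have X0 : X !=set0 by exists a; apply: hAB.
have bX : pp_boolean X.
  rewrite (_ : X = [set x | exists2 i, i \in enum 'I_m & B i x]).
    apply: pp_boolean_exists => i _; apply: definable_pp_boolean => //.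
    by case: (hB i).
  by apply/seteqP; split=> x [i _ Bx]; exists i; rewrite ?mem_enum.
have [i0 _ _] := hAB _ Aa.
have [D admD wD] : component_counts X m.
  move: hlambda; rewrite /lambda; case: eqP => [XE|_].
    by case: X0 => x; rewrite XE.
  case: xgetP => [k -> [Xk _] <-//|_ m0].
  by move: i0; rewrite -m0 => -[].
have [c [cE cV]] := component_map hM (admissible_adapted bX admD) X0.
have const Y : connected_definable Y -> Y `<=` X ->
    forall x y, Y x -> Y y -> c [set x] = c [set y].
  move=> [dY _ [DY admY wY]] YX; apply: (connected_constant hM _ wY).
    by apply: admissible_adapted => //; exact: definable_pp_boolean.
  by move=> F G gF gG; apply: cE; [apply: generic_sub gF|apply: generic_sub gG].
have /choice[b Bb] i : exists x, B i x by case: (hB i).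
have cB i x : B i x -> c [set x] = c [set b i].
  by move=> Bx; apply: (const (B i)).
have inj : injective (fun i => c [set b i]).
  have /image_injP injI : #|[seq c [set b i] | i in 'I_m]| == #|'I_m|.
    rewrite eqn_leq leq_image_card card_ord -[X in (X <= _)%N]wD.
    apply/subset_leq_card/fintype.subsetP => v.
    rewrite !inE andbT => /eqP<-; have [x [i _ Bx] <-] := cV v.
    by apply/fintype.imageP; exists i; rewrite ?(cB i).
  by move=> i j; apply: injI.
have [i _ Ba] := hAB _ Aa.
have AB j x : A x -> B j x -> j = i.
  by move=> Ax Bx; apply: inj; rewrite -(cB _ _ Bx) -(cB _ _ Ba); apply: (const A).
exists i; split=> [x Ax|j /(_ _ Aa) Bja]; last exact/esym/(AB j a).
by have [j _ Bx] := hAB _ Ax; rewrite -(AB j x).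
Qed.
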